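(* Let $n\geq 2$ and let $t$ be an indeterminate. There is a representation (group homomorphism) $\eta_1:T_n\rightarrow\mathrm{GL}_n(\mathbb{Z}[t^{\pm1}])$ of the twin group $T_n$ given on generators, for $1\leq i\leq n-1$, by $$s_i\mapsto\left(\begin{array}{c|c|c} I_{i-1} & 0 & 0\\ \hline 0 & \begin{matrix}1-t & t\\ 2-t & t-1\end{matrix} & 0\\ \hline 0&0&I_{n-i-1}\end{array}\right).$$
   Context: For $n\geq 2$, the twin group $T_n$ is the group with generators $s_1,\ldots,s_{n-1}$ and defining relations $s_i^2=1$ for $1\leq i\leq n-1$, and $s_is_j=s_js_i$ for $|i-j|\geq 2$. $I_r$ denotes the $r\times r$ identity matrix. *)

(* Defs.v *)
From HB Require Import structures.
From mathcomp Require Import all_boot all_order all_algebra generic_quotient.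
From mathcomp Require Import boolp.

Set Implicit Arguments.
Unset Strict Implicit.
Unset Printing Implicit Defensive.

Import GRing.Theory.
Local Open Scope ring_scope.
Local Open Scope quotient_scope.

(* Words over X and the formal inverses of its elements: the letter (x, true)
   stands for x and (x, false) for x^-1. *)
Definition gword (X : Type) : Type := seq (X * bool).

Definition gword_inv (X : Type) (w : gword X) : gword X :=
  rev [seq (l.1, ~~ l.2) | l <- w].

Section Presentation.
Variables (X : choiceType) (R : gword X -> gword X -> Prop).

(* The smallest congruence on words that contains R and cancels the products
   x x^-1 and x^-1 x; the relations of a presentation are equations u = v,
   recorded as R u v. *)
Inductive pres_eq : gword X -> gword X -> Prop :=
| PresRefl u : pres_eq u u
| PresSym u v : pres_eq u v -> pres_eq v u
| PresTrans u v w : pres_eq u v -> pres_eq v w -> pres_eq u w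
| PresCat u u' v v' : pres_eq u u' -> pres_eq v v' -> pres_eq (u ++ v) (u' ++ v')
| PresCancel x b : pres_eq [:: (x, b); (x, ~~ b)] [::]
| PresRel u v : R u v -> pres_eq u v.

Definition pres_eqb : rel (gword X) := fun u v => `[< pres_eq u v >].

Lemma pres_eqb_refl : reflexive pres_eqb.
Proof. by move=> u; apply/asboolP; exact: PresRefl. Qed.

Lemma pres_eqb_sym : symmetric pres_eqb.
Proof. by move=> u v; apply/asboolP/asboolP; exact: PresSym. Qed.

Lemma pres_eqb_trans : transitive pres_eqb.
Proof.
by move=> v u w /asboolP uv /asboolP vw; apply/asboolP; exact: PresTrans uv vw.
Qed.

Canonical pres_equiv :=
  EquivRel pres_eqb pres_eqb_refl pres_eqb_sym pres_eqb_trans.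

Definition presented : Type := {eq_quot pres_eqb}.

HB.instance Definition _ := Choice.on presented.

Lemma pres_eqP u v : pres_eq u v <-> \pi_presented u = \pi_presented v.
Proof. by split=> [uv|/eqmodP/asboolP//]; apply/eqmodP/asboolP. Qed.

Lemma pres_repr u : pres_eq (repr (\pi_presented u)) u.
Proof. by apply/pres_eqP; rewrite reprK. Qed.

Lemma pres_mulVw u : pres_eq (gword_inv u ++ u) [::].
Proof.
elim: u => [|[x b] u IH]; first exact: PresRefl.
rewrite /gword_inv /= rev_cons -cats1 -catA /=.
apply: PresTrans IH; apply: PresCat; first exact: PresRefl.
have -> : (x, ~~ b) :: (x, b) :: u = [:: (x, ~~ b); (x, ~~ ~~ b)] ++ u.
  by rewrite negbK.
by apply: (PresCat (v' := u) (PresCancel _ _)); exact: PresRefl.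
Qed.

Lemma gword_invK : involutive (@gword_inv X).
Proof.
move=> u; rewrite /gword_inv map_rev revK -map_comp -[RHS]map_id.
by apply: eq_map => -[x b] /=; rewrite negbK.
Qed.

Lemma pres_mulwV u : pres_eq (u ++ gword_inv u) [::].
Proof. by rewrite -{1}[u]gword_invK; exact: pres_mulVw. Qed.

Definition pres_one : presented := \pi_presented [::].
Definition pres_mul (a b : presented) : presented := \pi_presented (repr a ++ repr b).
Definition pres_inv (a : presented) : presented := \pi_presented (gword_inv (repr a)).

Lemma pres_mulE u v :
  pres_mul (\pi_presented u) (\pi_presented v) = \pi_presented (u ++ v).
Proof. by apply/pres_eqP; apply: PresCat; exact: pres_repr. Qed.

Lemma pres_mulA : associative pres_mul.
Proof.
move=> a b c; elim/quotW: a => u; elim/quotW: b => v; elim/quotW: c => w.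
by rewrite (pres_mulE v w) (pres_mulE u v) !pres_mulE catA.
Qed.

Lemma pres_mul1 : left_id pres_one pres_mul.
Proof. by move=> a; elim/quotW: a => u; rewrite pres_mulE. Qed.

Lemma pres_mulr1 : right_id pres_one pres_mul.
Proof. by move=> a; elim/quotW: a => u; rewrite pres_mulE cats0. Qed.

Lemma pres_mulV : left_inverse pres_one pres_inv pres_mul.
Proof.
move=> a; rewrite -{2}[a]reprK pres_mulE; apply/pres_eqP; exact: pres_mulVw.
Qed.

Lemma pres_mulrV : right_inverse pres_one pres_inv pres_mul.
Proof.
move=> a; rewrite -{1}[a]reprK pres_mulE; apply/pres_eqP; exact: pres_mulwV.
Qed.

HB.instance Definition _ := isGroup.Build presented
  pres_mulA pres_mul1 pres_mulr1 pres_mulV pres_mulrV.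

Definition pres_gen (x : X) : presented := \pi_presented [:: (x, true)].

End Presentation.

(* The generators s_1, ..., s_{n-1} are indexed from 0: i : 'I_n.-1 stands for
   s_{i+1}. *)
Inductive twin_rel (n : nat) : gword 'I_n.-1 -> gword 'I_n.-1 -> Prop :=
| TwinInvol (i : 'I_n.-1) : twin_rel [:: (i, true); (i, true)] [::]
| TwinComm (i j : 'I_n.-1) : (2 <= `|i - j|)%N ->
    twin_rel [:: (i, true); (j, true)] [:: (j, true); (i, true)].

Definition twin_group (n : nat) : Type := presented (@twin_rel n).

HB.instance Definition _ n := Group.on (twin_group n).

Definition twin_gen (n : nat) (i : 'I_n.-1) : twin_group n :=
  pres_gen (@twin_rel n) i.

(* R[t, t^-1], as the subring of the fractions p / t^k in R(t). *)
Section Laurent.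
Variable R : idomainType.

Local Notation frac := {fraction {poly R}}.
Local Notation "p %:F" := (@tofrac {poly R} p).

Definition is_laurent (f : frac) : bool :=
  `[< exists (p : {poly R}) (k : nat), f = p%:F / ('X^k)%:F >].

Lemma fracXn_neq0 k : ('X^k)%:F != 0 :> frac.
Proof. by rewrite tofrac_eq0 monic_neq0 ?monicXn. Qed.

Lemma is_laurent_subring : subring_closed is_laurent.
Proof.
split.
- apply/asboolP; exists 1, 0%N.
  by rewrite expr0 tofrac1 invr1 mulr1.
- move=> _ _ /asboolP[p [k ->]] /asboolP[q [l ->]]; apply/asboolP.
  exists (p * 'X^l - q * 'X^k), (k + l)%N.
  rewrite -mulNr addf_div ?fracXn_neq0// mulNr.
  by rewrite tofracB exprD !tofracM.
- move=> _ _ /asboolP[p [k ->]] /asboolP[q [l ->]]; apply/asboolP.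
  by exists (p * q), (k + l)%N; rewrite exprD !tofracM invfM mulrACA.
Qed.

Record laurent : Type :=
  Laurent { laurent_frac : frac; laurent_fracP : is_laurent laurent_frac }.

HB.instance Definition _ := [isSub for laurent_frac].
HB.instance Definition _ := [Choice of laurent by <:].
HB.instance Definition _ :=
  GRing.SubChoice_isSubComNzRing.Build frac is_laurent laurent
    is_laurent_subring.

Definition laurent_unit : {pred laurent} :=
  [pred f : laurent | (val f != 0) && is_laurent (val f)^-1].

Definition laurent_inv (f : laurent) : laurent :=
  if f \in laurent_unit then insubd f (val f)^-1 else f.

Lemma laurent_mulVx : {in laurent_unit, left_inverse 1 laurent_inv *%R}.
Proof.
move=> f fU; apply: val_inj; rewrite /laurent_inv fU.
move: fU => /andP[f0 fV]; rewrite rmorphM rmorph1 /= val_insubd fV.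
exact: mulVf.
Qed.

Lemma laurent_unitPl (f g : laurent) : g * f = 1 -> laurent_unit f.
Proof.
move=> /(congr1 val); rewrite rmorphM rmorph1 => gf1.
have f0 : val f != 0.
  by apply/eqP => f0; move/eqP: gf1; rewrite /= f0 mulr0 eq_sym oner_eq0.
rewrite /laurent_unit /= f0 /=.
have -> : (val f)^-1 = val g.
  by apply: (mulIf f0); rewrite mulVf.
exact: valP.
Qed.

Lemma laurent_inv_out : {in [predC laurent_unit], laurent_inv =1 id}.
Proof. by move=> f; rewrite inE /= /laurent_inv => /negbTE ->. Qed.

HB.instance Definition _ := GRing.ComNzRing_hasMulInverse.Build laurent
  laurent_mulVx laurent_unitPl laurent_inv_out.

Lemma laurentX_subproof : is_laurent 'X%:F.
Proof. by apply/asboolP; exists 'X, 0%N; rewrite expr0 tofrac1 invr1 mulr1. Qed.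

Definition laurentX : laurent := Laurent laurentX_subproof.

End Laurent.

(* MathComp's {'GL_n[R]} requires R to be finite. *)
Section GeneralLinear.
Variables (n : nat) (R : comUnitRingType).

Record GL : Type := MkGL { GL_mx : 'M[R]_n; GL_mxP : GL_mx \in unitmx }.

HB.instance Definition _ := [isSub for GL_mx].
HB.instance Definition _ := [Choice of GL by <:].

Lemma GL_mul_subproof (A B : GL) : GL_mx A *m GL_mx B \in unitmx.
Proof. by rewrite unitmx_mul !GL_mxP. Qed.

Lemma GL_inv_subproof (A : GL) : invmx (GL_mx A) \in unitmx.
Proof. by rewrite unitmx_inv GL_mxP. Qed.

Definition GL_one : GL := MkGL (unitmx1 R n).
Definition GL_mul (A B : GL) : GL := MkGL (GL_mul_subproof A B).
Definition GL_inv (A : GL) : GL := MkGL (GL_inv_subproof A).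

Lemma GL_mulA : associative GL_mul.
Proof. by move=> A B C; apply: val_inj; rewrite /= mulmxA. Qed.

Lemma GL_mul1 : left_id GL_one GL_mul.
Proof. by move=> A; apply: val_inj; rewrite /= mul1mx. Qed.

Lemma GL_mulr1 : right_id GL_one GL_mul.
Proof. by move=> A; apply: val_inj; rewrite /= mulmx1. Qed.

Lemma GL_mulV : left_inverse GL_one GL_inv GL_mul.
Proof. by move=> A; apply: val_inj; rewrite /= mulVmx ?GL_mxP. Qed.

Lemma GL_mulrV : right_inverse GL_one GL_inv GL_mul.
Proof. by move=> A; apply: val_inj; rewrite /= mulmxV ?GL_mxP. Qed.

HB.instance Definition _ := isGroup.Build GL
  GL_mulA GL_mul1 GL_mulr1 GL_mulV GL_mulrV.

End GeneralLinear.

Lemma local_mx_dim (n : nat) (i : 'I_n.-1) : (i + (2 + (n - i - 2)) = n)%N.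
Proof.
case: n i => [|[|n]] [i ltin] //=.
by rewrite -subnDA addnA subnKC // addn2.
Qed.

(* The block-diagonal matrix diag(I_i, B, I_{n-i-2}), with i counted from 0. *)
Definition local_mx (R : comUnitRingType) (n : nat) (i : 'I_n.-1) (B : 'M[R]_2) :
    'M[R]_n :=
  castmx (local_mx_dim i, local_mx_dim i)
    (block_mx (1%:M : 'M_i) 0 0 (block_mx B 0 0 (1%:M : 'M_(n - i - 2)))).

(* Main.v *)
Require Import Defs.
From HB Require Import structures.
From mathcomp Require Import all_boot all_order all_algebra.
From mathcomp Require Import ring zify.

(** A map from the generators of a presented group to a group extends to a
    homomorphism as soon as it respects the defining relations
    ([pres_morphism_exists]), so it is enough to check the two families of
    relations of the twin group on matrices.

    - Involutions: [B |-> diag (I, B, I)] is multiplicative ([local_mxM]), and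
      the 2 x 2 block squares to the identity: its trace is 0 and its
      determinant is - (1 - t)^2 - t (2 - t) = -1, so Cayley-Hamilton gives
      B^2 = I. The involution is its own inverse, so it lies in GL.
    - Far commutation: [diag (I, B, I)] placed at [i] is
      I + P_i^T (B - I) P_i, where P_i extracts the coordinates [i] and [i + 1]
      ([local_mxE]). If [i] and [j] are at distance at least 2, the coordinates
      extracted by P_i and P_j are disjoint, so P_i P_j^T = 0, both
      perturbations of the identity annihilate each other, and the two
      matrices commute ([local_mx_comm]). *)

Set Implicit Arguments.
Unset Strict Implicit.
Unset Printing Implicit Defensive.

Import GRing.Theory.
Local Open Scope ring_scope.

Definition gword_eval (X : Type) (G : groupType) (f : X -> G) (w : gword X) : G :=
  (\prod_(l <- w) (if l.2 then f l.1 else (f l.1)^-1))%g.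

(** Having the same value under [f] is a congruence on words that cancels both
    [x x^-1] and [x^-1 x]; it contains [pres_eq], the smallest such congruence containing
    the relations. *)
Lemma gword_eval_pres_eq (X : choiceType) (R : gword X -> gword X -> Prop)
    (G : groupType) (f : X -> G) :
    (forall u v, R u v -> gword_eval f u = gword_eval f v) ->
  forall u v, pres_eq R u v -> gword_eval f u = gword_eval f v.
Proof.
move=> fR u v; elim=> {u v}//.
- by move=> u v w _ -> _ ->.
- by move=> u u' v v' _ uu' _ vv'; rewrite /gword_eval !big_cat /=; congr (_ * _)%g.
- move=> x b; rewrite /gword_eval !big_cons !big_nil mulg1.
  by case: b; rewrite /= ?mulgV ?mulVg.
Qed.

Lemma pres_morphism_exists (X : choiceType) (R : gword X -> gword X -> Prop)
    (G : groupType) (f : X -> G) :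
    (forall u v, R u v -> gword_eval f u = gword_eval f v) ->
  exists phi : {multiplicative presented R -> G},
    forall x, phi (pres_gen R x) = f x.
Proof.
move=> /gword_eval_pres_eq f_eq.
pose phi (a : presented R) : G := gword_eval f (generic_quotient.repr a).
have phiM : {morph phi : a b / (a * b)%g}.
  move=> a b; rewrite /phi (f_eq _ _ (pres_repr _ _)).
  by rewrite /gword_eval big_cat.
exists (HB.pack_for {multiplicative presented R -> G} phi
          (isMultiplicative.Build _ _ phi phiM)) => x /=.
by rewrite /phi (f_eq _ _ (pres_repr _ _)) /gword_eval big_seq1.
Qed.

Section LocalMatrices.
Variables (R : comUnitRingType) (n : nat).
Implicit Types (i j : 'I_n.-1) (B C : 'M[R]_2).

Definition coord2_mx i : 'M[R]_(2, n) :=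
  \matrix_(a, k) (k == (i + a)%N :> nat)%:R.

(** The entrywise definition makes products such as P_i P_j^T easy to evaluate;
    the block form matches the shape of [local_mx]. *)
Lemma coord2_mx_block i :
  coord2_mx i =
    castmx (erefl, local_mx_dim i) (row_mx 0 (row_mx 1%:M 0)).
Proof.
apply/matrixP => a k; rewrite castmxE !mxE.
case: splitP => /= [l kl|l kl]; rewrite mxE.
  by case: eqP => // kE; have := ltn_ord l; lia.
case: splitP => /= [b lb|b lb]; rewrite !mxE.
  by rewrite kl lb eqn_add2l cast_ord_id eq_sym.
by case: eqP => // kE; have := ltn_ord a; lia.
Qed.

(** Since only the central block of [local_mx i B - 1] is nonzero, this
    difference factors through the two coordinates on which [B] acts. This
    form allows matrices at different positions, whose block decompositions
    do not match, to be multiplied. *)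
Lemma local_mxE i B :
  local_mx i B = 1%:M + (coord2_mx i)^T *m (B - 1%:M) *m coord2_mx i.
Proof.
rewrite coord2_mx_block /local_mx.
(* [n] also occurs in the block sizes; hiding those occurrences leaves an
   equation that can be eliminated, which makes the cast trivial. *)
move: (local_mx_dim i); move: (n - i - 2)%N => m; move: (nat_of_ord i) => p e.
case: n / e; rewrite !castmx_id !tr_row_mx trmx1 !trmx0.
rewrite !(mul_col_mx _ _ (B - 1%:M)).
rewrite !mul_col_row !(mul0mx, mulmx0, mulmx1).
rewrite (scalar_mx_block p) (scalar_mx_block 2 m) !add_block_mx.
by rewrite !(addr0, add0r) mul1mx subrKC.
Qed.

Lemma local_mx1 i : local_mx i 1%:M = 1%:M :> 'M[R]_n.
Proof. by rewrite local_mxE subrr mulmx0 mul0mx addr0. Qed.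

Lemma local_mxM i B C : local_mx i B *m local_mx i C = local_mx i (B *m C).
Proof.
rewrite /local_mx; move: (local_mx_dim i).
move: (n - i - 2)%N => m; move: (nat_of_ord i) => p e.
case: n / e; rewrite !castmx_id !mulmx_block.
by rewrite !(mulmx0, mul0mx, mulmx1, mul1mx, addr0, add0r).
Qed.

Lemma coord2_mx_disjoint i j :
  (2 <= `|i - j|)%N -> coord2_mx i *m (coord2_mx j)^T = 0.
Proof.
move=> ij; apply/matrixP => a b; rewrite !mxE big1 // => k _; rewrite !mxE.
case: eqP => [ka|_]; last by rewrite mul0r.
case: eqP => [kb|_]; last by rewrite mulr0.
by have := ltn_ord a; have := ltn_ord b; lia.
Qed.

Lemma local_mx_comm i j B C : (2 <= `|i - j|)%N ->
  local_mx i B *m local_mx j C = local_mx j C *m local_mx i B.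
Proof.
move=> ij; have ji : (2 <= `|j - i|)%N by lia.
have perturb0 k l D E : coord2_mx k *m (coord2_mx l)^T = 0 ->
    (coord2_mx k)^T *m D *m coord2_mx k *m
      ((coord2_mx l)^T *m E *m coord2_mx l) = 0.
  by move=> kl; rewrite !mulmxA -(mulmxA _ (coord2_mx k)) kl mulmx0 !mul0mx.
rewrite !local_mxE; move: (B - 1%:M) (C - 1%:M) => D E.
rewrite !mulmxDl !mulmxDr !mul1mx !mulmx1.
rewrite !perturb0 ?coord2_mx_disjoint // !addr0 -!addrA; congr (_ + _).
by rewrite addrC.
Qed.

End LocalMatrices.

Lemma twin_block_sqr (R : comUnitRingType) (t : R) :
  let B : 'M_(1 + 1) := block_mx (1 - t)%:M t%:M (2 - t)%:M (t - 1)%:M in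
  B *m B = 1%:M.
Proof.
rewrite /= mulmx_block -!scalar_mxM -!raddfD /=.
rewrite [in RHS]scalar_mx_block; congr block_mx.
- by congr (_%:M); ring.
- by rewrite -[RHS](raddf0 (@scalar_mx _ 1)); congr (_%:M); ring.
- by rewrite -[RHS](raddf0 (@scalar_mx _ 1)); congr (_%:M); ring.
- by congr (_%:M); ring.
Qed.

Theorem proposition5 (n : nat) (hn : (2 <= n)%N) :
  let t : laurent int := laurentX int in
  exists eta1 : {multiplicative twin_group n -> GL n (laurent int)},
    forall i : 'I_n.-1,
      GL_mx (eta1 (twin_gen i)) =
        local_mx i (block_mx (1 - t)%:M t%:M (2 - t)%:M (t - 1)%:M : 'M_(1 + 1)).
Proof.
move=> t; set B := block_mx _ _ _ _.
have BB i : local_mx i B *m local_mx i B = 1%:M :> 'M_n.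
  by rewrite local_mxM twin_block_sqr local_mx1.
pose s i : GL n (laurent int) := MkGL (mulmx1_unit (BB i)).1.
have sR u v : twin_rel u v -> gword_eval s u = gword_eval s v.
  case=> [i|i j ij]; apply: val_inj; rewrite /gword_eval !(big_cons, big_nil) !mulg1.
    exact: BB.
  exact: local_mx_comm.
by have [eta1 eta1E] := pres_morphism_exists sR; exists eta1 => i; rewrite eta1E.
Qed.
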